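(* Let $D=(V,E)$ be a finite digraph without loops and $H=(U,F)$ a digraph (loops allowed), and let $\varsigma\colon E\to U$ be an $H$-colouring of $D$. If every directed cycle of $D$ is an $H$-cycle, then $D$ has an $H$-kernel by walks.
   Context: An $H$-colouring of $D$ is a function $\varsigma\colon E\to U$. A walk $z_0z_1\dots z_k$ ($k\ge 1$) in $D$ is an $H$-walk if the sequence of colours $\varsigma(z_0z_1),\dots,\varsigma(z_{k-1}z_k)$ is a walk in $H$, i.e. for each $1\le i\le k-1$, $\varsigma(z_{i-1}z_i)\varsigma(z_iz_{i+1})\in F$. A directed cycle of $D$ is an $H$-cycle if the colours of its arcs, read cyclically, form a closed walk in $H$ (every two consecutive arcs of the cycle, including the last and the first, have colours forming an arc of $H$). A set $K\subseteq V$ is $H$-independent (by walks) if there is no $H$-walk between any two distinct elements of $K$; it is $H$-absorbent (by walks) if for every $v\in V\setminus K$ there is an $H$-walk from $v$ to some element of $K$. An $H$-kernel (by walks) is a set that is both $H$-independent and $H$-absorbent. *)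

(* Defs.v *)
From mathcomp Require Import all_boot.

Set Implicit Arguments.
Unset Strict Implicit.
Unset Printing Implicit Defensive.

(* A finite digraph is D = (V, e); a (possibly infinite) digraph is H = (U, F),
   with loops allowed as F is an arbitrary relation. *)

Definition arc_of (V : finType) (e : rel V) := {a : V * V | e a.1 a.2}.

Section HColouring.

Variables (V : finType) (e : rel V) (U : Type) (F : U -> U -> Prop).

(* F (c (x, y)) (c (y, z)), for consecutive arcs (x, y) and (y, z). An arc is
   determined by its endpoints, so a and b are unique when they exist. *)
Definition compatible (c : arc_of e -> U) (x y z : V) : Prop :=
  forall a b : arc_of e, val a = (x, y) -> val b = (y, z) -> F (c a) (c b).

Definition Hwalk (c : arc_of e -> U) (z0 : V) (p : seq V) : Prop :=
  [/\ 0 < size p, path e z0 p &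
      forall i, i.+1 < size p ->
        let z := nth z0 (z0 :: p) in compatible c (z i) (z i.+1) (z i.+2)].

Definition Hwalk_from_to (c : arc_of e -> U) (x y : V) : Prop :=
  exists2 p : seq V, Hwalk c x p & last x p = y.

Definition dicycle (s : seq V) : Prop := 0 < size s /\ ucycle e s.

Definition Hcycle (c : arc_of e -> U) (s : seq V) : Prop :=
  dicycle s /\
  forall x, x \in s -> compatible c x (next s x) (next s (next s x)).

Definition Hindependent (c : arc_of e -> U) (K : {set V}) : Prop :=
  forall x y, x \in K -> y \in K -> x != y -> ~ Hwalk_from_to c x y.

Definition Habsorbent (c : arc_of e -> U) (K : {set V}) : Prop :=
  forall v, v \notin K -> exists2 u, u \in K & Hwalk_from_to c v u.

Definition Hkernel (c : arc_of e -> U) (K : {set V}) : Prop :=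
  Hindependent c K /\ Habsorbent c K.

End HColouring.

(* Main.v *)
Require Import Defs.
From mathcomp Require Import all_boot.
From mathcomp Require Import boolp.

(** Let [R x y] mean that there is an H-walk from [x] to [y].  It suffices that
    the strict part of [R] has no cycles: then every nonempty set [W] of vertices
    contains some [x] with [R x y -> R y x] for all [y] in [W]; put [x] in the
    kernel, discard the vertices absorbed by [x], and iterate.

    Two consecutive arcs lying on a common cycle are compatible.  Two facts
    follow, by looking at first returns of closed walks.
    - If [R x y], [R y z] and [R z x], then [R z y] or [R y x].
    - Every [R]-cycle of length at least 2 has consecutive vertices [i], [j], [k]
      with [R i k].
    In a shortest cycle of the strict part, the second fact gives a chord [R i k],
    which is not strict by minimality; the first fact then contradicts the
    strictness of [R i j] or of [R j k]. *)

(** * Kernels of relations with acyclic strict part *)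

Section Kernels.

Context {V : finType}.
Implicit Types (S R : rel V) (K W : {set V}).

(** Take [x] in [W] with the fewest vertices reachable by [S]. For a successor [y] in [W],
    minimality makes the two reachable sets equal, so [y] reaches [x] and closes a cycle. *)
Lemma acyclic_sink S W :
  (forall x s, s != [::] -> path S x s -> last x s != x) -> W != set0 ->
  exists2 x, x \in W & {in W, forall y, ~~ S x y}.
Proof.
move=> acS /set0Pn[x0 Wx0].
case: (@arg_minnP _ x0 (mem W) (fun x => #|connect S x|) Wx0) => x Wx min_x.
exists x => // y Wy; apply/negP => Sxy.
have sub : connect S y \subset connect S x.
  by apply/subsetP => z; rewrite !inE; apply/connect_trans/connect1.
have /connectP[p yp xE] : connect S y x.
  have /subset_leqif_card/leqifP := sub; case: ifP => [/subsetP/(_ x) + _|_].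
    by apply; rewrite inE connect0.
  by rewrite ltnNge min_x.
by have := acS x (y :: p) isT; rewrite /= Sxy yp -xE eqxx => /(_ isT).
Qed.

Lemma acyclic_strict_kernel R :
  (forall x s, s != [::] -> path [rel i j | R i j && ~~ R j i] x s ->
     last x s != x) ->
  exists K, {in K &, forall x y, x != y -> ~~ R x y} /\
    forall v, v \notin K -> exists2 u, u \in K & R v u.
Proof.
move=> acR.
suff: forall n W, #|W| <= n -> exists K, [/\ K \subset W,
    {in K &, forall x y, x != y -> ~~ R x y} &
    forall v, v \in W -> v \notin K -> exists2 u, u \in K & R v u].
  case/(_ _ setT (leqnn _)) => K [_ indK absK].
  by exists K; split=> // v; apply: absK.
elim=> [|n IHn] W leW.
  have /eqP W0 : W == set0 by rewrite -cards_eq0 -leqn0.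
  by exists set0; split=> [|x y|v]; rewrite ?W0 ?inE ?sub0set.
have [->|W0] := eqVneq W set0.
  by exists set0; split=> [|x y|v]; rewrite ?inE ?sub0set.
have [x Wx sink_x] := acyclic_sink _ _ acR W0.
have [|K [sK indK absK]] := IHn [set y in W :\ x | ~~ R y x].
  rewrite -ltnS (leq_trans _ leW) // [leqRHS](cardsD1 x) Wx ltnS subset_leq_card //.
  by apply/subsetP => y; rewrite inE => /andP[].
have KP y : y \in K -> [/\ y != x, y \in W & ~~ R y x].
  by move/(subsetP sK); rewrite !inE => /andP[/andP[]].
exists (x |: K); split.
- by apply/subsetP => y; rewrite !inE => /orP[/eqP->|/KP[]].
- move=> y z; rewrite !inE => /orP[/eqP->|Ky] /orP[/eqP->|Kz]; last exact: indK.
  + by rewrite eqxx.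
  (* [x] is a sink only for the strict part, so [R x z] would force [R z x]; but vertices absorbed
     by [x] were discarded. *)
  + have [_ Wz nRzx] := KP _ Kz; move: (sink_x _ Wz) => /=.
    by rewrite nRzx andbT.
  + by have [] := KP _ Ky.
- move=> v Wv; rewrite !inE negb_or => /andP[vx vK].
  have [Rvx|nRvx] := boolP (R v x); first by exists x; rewrite ?setU11.
  have [|u Ku Rvu] := absK v _ vK; first by rewrite !inE vx Wv.
  by exists u; rewrite // inE Ku orbT.
Qed.

End Kernels.

(** * H-walks as paths between arcs *)

Section Walks.

Context {V : finType} {e : rel V} (e_loopless : irreflexive e).
Context {U : Type} {F : U -> U -> Prop} {c : arc_of e -> U}.

(** Taking arcs as vertices makes compatibility a binary relation: gluing walks along a compatible
    pair becomes transitivity of its closure [T]. *)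
Definition compat_arc : rel (V * V) := fun a b =>
  [&& e a.1 a.2, e b.1 b.2, a.2 == b.1 & `[< compatible F c a.1 a.2 b.2 >]].

Local Notation T := (connect compat_arc).

Definition walk_rel : rel V := fun x y =>
  [exists a, exists b, [&& e a.1 a.2, e b.1 b.2, a.1 == x, b.2 == y & T a b]].

Local Notation R := walk_rel.

Lemma walk_relI a b : e a.1 a.2 -> e b.1 b.2 -> T a b -> R a.1 b.2.
Proof.
move=> ea eb Tab; apply/existsP; exists a; apply/existsP; exists b.
by rewrite ea eb !eqxx.
Qed.

Lemma Hwalk_cons x w z p : Hwalk F c x [:: w, z & p] <->
  [/\ e x w, compatible F c x w z & Hwalk F c w (z :: p)].
Proof.
split.
  case=> _ /= /andP[exw pth] comp; split=> //; first exact: (comp 0).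
  split=> // i lti /=; have lti1 := ltnW lti; have lti2 := ltnW lti1.
  by have := comp i.+1 lti; rewrite /= !(set_nth_default w x).
case=> exw cxwz [_ pth comp]; split=> //; first by rewrite /= exw.
case=> [//|i] lti /=; have lti1 := ltnW lti; have lti2 := ltnW lti1.
by have := comp i lti; rewrite /= !(set_nth_default w x).
Qed.

Lemma walk_relP x y : reflect (Hwalk_from_to F c x y) (R x y).
Proof.
apply: (iffP existsP).
  case=> a /existsP[b /and5P[ea eb /eqP<- /eqP<- /connectP[s as_ bE]]].
  suff [p walk_p lastp] : exists2 p,
      Hwalk F c a.1 (a.2 :: p) & last a.2 p = b.2 by exists (a.2 :: p).
  elim: s a ea as_ bE => [|d s IHs] a ea /=.
    by move=> _ ->; exists [::] => //; split; rewrite //= ea.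
  case/andP=> /and4P[_ ed /eqP ad /asboolP cad] ds bE.
  have [p walk_p lastp] := IHs d ed ds bE.
  exists (d.2 :: p) => //; apply/Hwalk_cons; split=> //.
  by rewrite ad.
case=> -[|w p]; first by case.
suff: Hwalk F c x (w :: p) -> last w p = y -> exists b,
    [&& e x w, e b.1 b.2, b.2 == y & T (x, w) b].
  move=> H walk_p /(H walk_p)[b /and4P[exw eb yb Tb]].
  by exists (x, w); apply/existsP; exists b; rewrite exw eb eqxx yb.
elim: p x w => [|z p IHp] x w.
  case=> _ /=; rewrite andbT => exw _ <-; exists (x, w).
  by rewrite /= exw !eqxx connect0.
case/Hwalk_cons=> exw cxwz walk_p lastp.
have [b /and4P[ewz eb by_ Tb]] := IHp _ _ walk_p lastp.
exists b; rewrite exw eb by_ /=; apply: connect_trans Tb; apply: connect1.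
by rewrite /compat_arc /= exw ewz eqxx; apply/asboolP.
Qed.

(* [s] lists the vertices after the start [x].  Consecutive arcs are only
   required to be related by the closure [T], so that such a walk need not be
   an H-walk. *)
Definition simple_walk x s :=
  [/\ path e x s, uniq (x :: s) & sorted T (pairmap pair x s)].

Lemma simple_walk_suffix x s1 s2 :
  simple_walk x (s1 ++ s2) -> simple_walk (last x s1) s2.
Proof.
case; rewrite cat_path pairmap_cat => /andP[_ p2] u12 /cat_sorted2[_ T2].
split=> //; move: u12.
by rewrite -cat_cons lastI cat_rcons cat_uniq => /and3P[].
Qed.

Lemma simple_walk_last_arc x w s : simple_walk x (w :: s) ->
  e (last x (belast w s)) (last w s) /\
  T (x, w) (last x (belast w s), last w s).
Proof.
case=> + _ /=; elim: s x w => [|z s IHs] x w /=; first by rewrite andbT connect0.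
case/andP=> _ ps /andP[Txwz Ts]; have [el Tl] := IHs _ _ ps Ts.
by split=> //; apply: connect_trans Tl.
Qed.

Lemma simple_walk_rel x s : simple_walk x s -> s != [::] -> R x (last x s).
Proof.
case: s => // w s sw _; have [el Tl] := simple_walk_last_arc _ _ _ sw.
by case: sw => /= /andP[exw _] _ _; apply: walk_relI Tl.
Qed.

(** Prepend the first arc to a simple walk for the rest; if its source recurs there, keep only the
    part from that recurrence on. The first arc may thus change, but not its source; the last
    conjunct records the relation needed to prepend again. *)
Lemma connect_simple_walk a b : e a.1 a.2 -> T a b -> a.1 != b.2 ->
  exists w s, [/\ simple_walk a.1 (w :: s), last w s = b.2 & T a (a.1, w)].
Proof.
move=> ea /connectP[p ap bE]; elim: p a ea ap bE => [|a' p IHp] [x w] /= exw.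
  move=> _ -> /= xw; exists w, [::]; split; rewrite ?connect0 //.
  by split; rewrite /= ?exw // inE xw.
case/andP=> Ga a'p bE xb; case/and4P: (Ga) => _ /= ea' /eqP wE _.
have [wb|wb] := eqVneq w b.2.
  exists w, [::]; split; rewrite ?connect0 //.
  by split; rewrite /= ?exw // inE wb xb.
have [|z [s []]] := IHp _ ea' a'p bE; first by rewrite -wE.
rewrite -wE => sw lastE Ta'; have Txw : T (x, w) (w, z).
  by apply: connect_trans Ta'; apply: connect1.
have [xs|xs] := boolP (x \in z :: s); last first.
  exists w, (z :: s); split; rewrite ?connect0 //; case: sw => ps us Ts.
  split; [by rewrite /= exw | | by rewrite /= Txw].
  rewrite cons_uniq us andbT inE negb_or xs andbT; apply/eqP => xw.
  by rewrite xw e_loopless in exw.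
have Ts : path T (x, w) (pairmap pair w (z :: s)).
  by case: sw => _ _; rewrite /= Txw.
have {}lastE : last w (z :: s) = b.2 by [].
case/path.splitP: xs sw Ts lastE => s1 [|y s2] sw Ts.
  by rewrite cats0 last_rcons => lastE; rewrite lastE eqxx in xb.
rewrite last_cat last_rcons => lastE; exists y, s2; split=> //.
  by have := simple_walk_suffix _ _ _ sw; rewrite last_rcons.
have Ttr : transitive T by apply: connect_trans.
move: (order_path_min Ttr Ts); rewrite pairmap_cat last_rcons all_cat /=.
by case/and3P.
Qed.

Lemma walk_rel_simple x y : R x y -> x != y ->
  exists w s, simple_walk x (w :: s) /\ last w s = y.
Proof.
case/existsP=> a /existsP[b /and5P[ea _ /eqP<- /eqP<- Tab]].
by case/(connect_simple_walk _ _ ea Tab) => w [s [sw lastE _]]; exists w, s.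
Qed.

(** * Gluing walks when every cycle is an H-cycle *)

Context (Hcyc : forall s : seq V, dicycle e s -> Hcycle F c s).

(** Since the walk avoids [z] in between, shortening [w :: q] to a path gives a cycle with the same
    two arcs at [z]. *)
Lemma closed_walk_compat z w q : e (last w q) z -> path e z (w :: q) ->
  z \notin w :: q -> T (last w q, z) (z, w).
Proof.
move=> + /= /andP[ezw pq]; case/shortenP: pq => q' pq' uq' sub elz zq.
have zq' : z \notin w :: q'.
  apply: contra zq; rewrite !inE => /orP[->//|/sub ->]; exact: orbT.
have us : uniq [:: z, w & q'] by rewrite cons_uniq zq'.
apply: connect1; rewrite /compat_arc /= elz ezw eqxx; apply/asboolP.
have [|_ /(_ (last w q'))] := Hcyc [:: z, w & q'].
  by split=> //; rewrite /ucycle us /= ezw rcons_path pq' elz.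
have lin : last w q' \in [:: z, w & q'] by rewrite inE mem_last orbT.
(* The index of the last vertex is out of range for the tail, so [nth] returns its default, the head
   [z]. *)
have -> : next [:: z, w & q'] (last w q') = z.
  rewrite next_nth lin -[last w q']/(last z (w :: q')) index_last //.
  by rewrite nth_default.
by rewrite [next _ z]next_nth mem_head /= eqxx; apply.
Qed.

(** Follow the second path from [u] to a common vertex, then the first path back to [u]: this closed
    walk visits [u] only once. *)
Lemma crossing_paths_compat x p u w s : path e x (rcons p u) ->
  uniq (x :: rcons p u) -> path e u (w :: s) -> uniq (u :: w :: s) ->
  has (mem (x :: p)) (w :: s) -> T (last x p, u) (u, w).
Proof.
rewrite rcons_path -rcons_cons rcons_uniq.
move=> /andP[pp elu] /andP[up _] /= /andP[euw ps].
case/andP=> us _ /(@hasP _ _ (w :: s))[v vs vp].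
case/splitPl: vp pp elu up => p1 p2 p1v; case/splitPl: vs ps us => s1 s2 s1v.
rewrite cat_path => /andP[ps1 _]; rewrite -cat_cons mem_cat => /norP[us1 _].
rewrite cat_path last_cat p1v => /andP[_ pp2] elu.
rewrite -cat_cons mem_cat => /norP[_ up2].
have -> : last v p2 = last w (s1 ++ p2) by rewrite last_cat s1v.
apply: closed_walk_compat; rewrite ?last_cat ?s1v //=.
  by rewrite euw cat_path ps1 s1v.
by rewrite -cat_cons mem_cat negb_or us1.
Qed.

Lemma walk_rel_triangle x y z : R x y -> R y z -> R z x ->
  x != y -> y != z -> z != x -> R z y || R y x.
Proof.
move=> Rxy Ryz Rzx nxy nyz nzx.
have [w1 [s1 [sw1 last1]]] := walk_rel_simple _ _ Rzx nzx.
have [w2 [s2 [sw2 last2]]] := walk_rel_simple _ _ Rxy nxy.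
have [w3 [s3 [sw3 last3]]] := walk_rel_simple _ _ Ryz nyz.
(* If the walk from [x] to [y] passes through [z], its tail gives [R z y]. *)
have [zs2|zs2] := boolP (z \in w2 :: s2).
  have {}last2 : last x (w2 :: s2) = y by [].
  case/path.splitP: zs2 sw2 last2 => p [|v q] sw2.
    by rewrite cats0 last_rcons => zy; rewrite zy eqxx in nyz.
  rewrite last_cat last_rcons => <-.
  move/simple_walk_suffix: sw2; rewrite last_rcons => /simple_walk_rel -> //.
have [e1 T1] := simple_walk_last_arc _ _ _ sw1.
have [e3 T3] := simple_walk_last_arc _ _ _ sw3.
case: sw1 sw2 sw3 => p1 u1 _ [p2 _ _] [p3 u3 _].
have eyw3 : e y w3 by case/andP: p3.
rewrite last1 in e1 T1; rewrite last3 in e3 T3.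
move: p3 u3; rewrite [w3 :: s3]lastI last3 rcons_path => /andP[p3 _].
rewrite -rcons_cons rcons_uniq inE negb_or => /andP[/andP[_ zs3] _].
(* Otherwise the three walks form a closed walk meeting [z] only once, so the walks from [y] to [z]
   and from [z] to [x] glue at [z]. *)
have T31 : T (last y (belast w3 s3), z) (z, w1).
  have lE : last y (belast w3 s3) = last w1 (s1 ++ (w2 :: s2) ++ belast w3 s3).
    by rewrite !last_cat /= last2.
  rewrite lE; apply: closed_walk_compat; rewrite -?lE //.
    move: p1 => /= /andP[ezw ps1]; rewrite ezw cat_path ps1 last1.
    by rewrite -cat_cons cat_path p2 /= last2.
  rewrite -cat_cons !mem_cat; apply/norP; split; first by case/andP: u1.
  exact/norP.
apply/orP; right; apply: (walk_relI (y, w3) (last z (belast w1 s1), x)) => //.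
exact: connect_trans T3 (connect_trans T31 T1).
Qed.

(* Extend the simple path [x :: rcons p b] along the given walks until it first
   meets itself; it must then close up around the last vertex where two of the
   walks were glued, and they are compatible there. *)
Lemma walk_rel_shortcut s a b x p v : s != [::] ->
  path [rel i j | R i j && (i != j)] a (b :: s) -> last b s \in x :: p ->
  path e x (rcons p b) -> uniq (x :: rcons p b) ->
  e a v -> T (a, v) (last x p, b) ->
  exists s1 i j k s2, a :: b :: s = s1 ++ [:: i, j, k & s2] /\ R i k.
Proof.
elim: s a b x p v => // d s IHs a b x p v _ prs lastin pp up eav Tav.
case/and3P: prs => Rab /andP[Rbd nbd] ps.
have [w [q [sw lastE]]] := walk_rel_simple _ _ Rbd nbd.
have [ed Td] := simple_walk_last_arc _ _ _ sw; rewrite lastE in ed Td.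
case: (sw) => pq uq _; have ebw : e b w by case/andP: pq.
have [meet|nmeet] := boolP (has (mem (x :: p)) (w :: q)).
  exists [::], a, b, d, s; split=> //.
  have Tpb := crossing_paths_compat _ _ _ _ _ pp up pq uq meet.
  apply: (walk_relI (a, v) (last b (belast w q), d)) => //.
  exact: connect_trans Tav (connect_trans Tpb Td).
(* Otherwise [d] is the final vertex, which lies on [x :: p], and the walk ending at [d] would have
   met it. *)
have s0 : s != [::].
  apply: contra nmeet => /eqP s0; apply/(@hasP _ _ (w :: q)); exists d.
    by rewrite -lastE mem_last.
  by rewrite s0 /= in lastin.
have rE : rcons (rcons p b ++ belast w q) d = rcons p b ++ w :: q.
  by rewrite rcons_cat -lastE -lastI.
have [|||||s1 [i [j [k [s2 [sE Rik]]]]]] :=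
  IHs b d x (rcons p b ++ belast w q) w s0 _ _ _ _ ebw.
- by rewrite /= Rbd nbd.
- by rewrite cat_rcons -cat_cons mem_cat lastin.
- by rewrite rE cat_path pp last_rcons.
- rewrite rE -cat_cons cat_uniq up; move: uq; rewrite cons_uniq => /andP[bq ->].
  rewrite andbT; apply/hasPn => y yq; rewrite -rcons_cons mem_rcons inE negb_or.
  have := hasPn nmeet y yq => /= ->; rewrite andbT.
  by apply: contra bq => /eqP <-.
- by rewrite last_cat last_rcons.
- by exists (a :: s1), i, j, k, s2; rewrite sE.
Qed.

Lemma walk_rel_strict_acyclic x s : s != [::] ->
  path [rel i j | R i j && ~~ R j i] x s -> last x s != x.
Proof.
have [n] := ubnP (size s); elim: n x s => // n IHn x [//|b s] /ltnSE lesn _ pxs.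
apply/negP => /eqP /= lastE.
have neqS i j : R i j && ~~ R j i -> i != j.
  by apply: contraTneq => ->; rewrite andbN.
have s0 : s != [::].
  by apply: contraTneq pxs => s0; rewrite s0 /= in lastE; rewrite lastE /= andbN.
move: (pxs) => /= /andP[Sxb _]; case/andP: (Sxb) => Rxb _.
have [w [q [sw lastq]]] := walk_rel_simple _ _ Rxb (neqS _ _ Sxb).
have [_ Tq] := simple_walk_last_arc _ _ _ sw; rewrite lastq in Tq.
have exw : e x w by case: sw => /andP[].
case: sw; rewrite [w :: q]lastI lastq => pq uq _.
(* The initial path is a simple walk from [x] to [b]; the cycle ends at [x], which lies on it, so a
   meeting must occur. *)
have [||s1 [i [j [k [s2 [sE Rik]]]]]] :=
  walk_rel_shortcut s x b x (belast w q) w s0 _ _ pq uq exw Tq.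
- by apply: sub_path pxs => i j /= Sij; rewrite (neqS _ _ Sij); case/andP: Sij => ->.
- by rewrite lastE mem_head.
set S := [rel i j | R i j && ~~ R j i] in IHn pxs.
have : sorted S (s1 ++ [:: i, j, k & s2]) by rewrite -sE.
case/cat_sorted2 => _ /= /and3P[Sij Sjk _].
have Sik : S i k.
  rewrite /= Rik; apply/negP => Rki.
  case/andP: (Sij) (Sjk) => Rij nRji /andP[Rjk nRkj].
  have nki : k != i by apply: contraNneq nRji => <-.
  have := walk_rel_triangle _ _ _ Rij Rjk Rki (neqS _ _ Sij) (neqS _ _ Sjk) nki.
  by rewrite (negbTE nRji) (negbTE nRkj).
have shorter t : t != [::] -> size t <= size s -> path S x t -> last x t <> x.
  by move=> t0 lets pt; apply/eqP/IHn => //; apply: leq_ltn_trans lets lesn.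
(* As [j] is strictly between [i] and [k], deleting it keeps both ends at [x] and shortens the
   cycle. *)
case: s1 sE => [|? s1] [xE].
  move=> bE sE; apply: (shorter (k :: s2)); rewrite ?sE //=.
    by rewrite sE /= in pxs; case/and3P: pxs => _ _ ->; rewrite andbT xE.
  by rewrite -lastE sE.
move=> sE; apply: (shorter (s1 ++ [:: i, k & s2])).
- by case: (s1).
- by rewrite -ltnS -[(size s).+1]/(size (b :: s)) sE !size_cat !addnS.
- move: pxs; rewrite sE !cat_path /= => /and5P[-> -> _ _ ->].
  by rewrite andbT.
- by rewrite -[RHS]lastE -[last b s]/(last x (b :: s)) sE !last_cat.
Qed.

End Walks.

Theorem theorem1 (V : finType) (e : rel V) (e_loopless : irreflexive e)
    (U : Type) (F : U -> U -> Prop) (c : arc_of e -> U) :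
  (forall s : seq V, dicycle e s -> Hcycle F c s) ->
  exists K : {set V}, Hkernel F c K.
Proof.
move=> Hcyc.
have [K [indK absK]] :=
  acyclic_strict_kernel _ (walk_rel_strict_acyclic e_loopless Hcyc).
exists K; split=> [x y Kx Ky xy|v /absK[u Ku /walk_relP Rvu]]; last by exists u.
by move/walk_relP; apply/negP/indK.
Qed.
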